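(* Let $p$ be a prime number such that $p \equiv 3 \pmod 4$. Then: (i) if $p \equiv 3 \pmod 8$, then $\kappa(4p) \equiv \kappa(8p) \equiv 2 \pmod 4$; (ii) if $p \equiv 7 \pmod 8$, then $\kappa(4p) \equiv \kappa(8p) \equiv 0 \pmod 4$.
   Context: A real quadratic number is a real irrational root $w$ of a quadratic polynomial with integer coefficients; $w'$ denotes its algebraic conjugate over $\mathbb{Q}$. The discriminant $\mathrm{disc}(w)$ of $w$ is $b^2-4ac$, where $aw^2+bw+c=0$ with $a,b,c\in\mathbb{Z}$, $a>0$, $\gcd(a,b,c)=1$. A real quadratic number $w$ is reduced if $w>1$ and $-1<w'<0$. For a positive non-square integer $D$, $\kappa(D)$ denotes the (finite) number of reduced real quadratic numbers $w$ with $\mathrm{disc}(w)=D$. *)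

(* Defs.v *)
From mathcomp Require Import all_boot all_order all_algebra.
From mathcomp Require Import ring lra.
From mathcomp Require Import finmap.
From mathcomp Require Import boolp classical_sets functions cardinality reals.

Set Implicit Arguments.
Unset Strict Implicit.
Unset Printing Implicit Defensive.
Import Order.TTheory GRing.Theory Num.Theory.
Local Open Scope classical_set_scope.
Local Open Scope ring_scope.

Definition real_quadratic (R : realType) (w : R) : Prop :=
  irrational w /\
  exists f : {poly int}, size f = 3%N /\ root (map_poly intr f) w.

(* [w'] is a root, other than [w], of the minimal polynomial of [w] over the
   rationals. For a real quadratic [w] there is exactly one such [w']. *)
Definition conjugate (R : realType) (w w' : R) : Prop :=
  w' != w /\
  forall f : {poly rat}, root (map_poly ratr f) w -> root (map_poly ratr f) w'.

(* Graph of the function disc: the triple (a, b, c) is determined by the real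
   quadratic number [w], hence so is [d]. *)
Definition has_disc (R : realType) (w : R) (d : int) : Prop :=
  exists a b c : int,
    [/\ a%:~R * w ^+ 2 + b%:~R * w + c%:~R = 0, 0 < a,
        gcdz (gcdz a b) c = 1 & d = b ^+ 2 - 4 * a * c].

Definition reduced (R : realType) (w : R) : Prop :=
  1 < w /\ exists w' : R, [/\ conjugate w w', -1 < w' & w' < 0].

Definition reduced_disc (R : realType) (D : nat) : set R :=
  [set w : R | [/\ real_quadratic w, reduced w & has_disc w D%:Z]].

Lemma finite_reduced_disc (R : realType) (D : nat) :
  finite_set (@reduced_disc R D).
Proof.
pose f (x : 'I_D.+1 * 'I_D.+1) : R :=
  ((x.2 : nat)%:R + Num.sqrt D%:R) / (2 * (x.1 : nat)%:R).
apply: (@sub_finite_set _ _ (f @` setT)); last exact/finite_image/finite_finset.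
move=> w [_ [w_gt1 [w' [[w'_neq conj_w] w'_gt w'_lt]]]].
move=> [a [b [c [eq_w a_gt0 _ eqD]]]].
have eq_w' : a%:~R * w' ^+ 2 + b%:~R * w' + c%:~R = 0 :> R.
  pose g : {poly rat} := a%:~R *: 'X^2 + b%:~R *: 'X + (c%:~R)%:P.
  have gE x : (map_poly ratr g).[x] = a%:~R * x ^+ 2 + b%:~R * x + c%:~R :> R.
    by rewrite !rmorphD /= !map_polyZ /= map_polyXn map_polyX map_polyC /=
               !hornerE !ratr_int.
  have : root (map_poly ratr g) w by rewrite /root gE eq_w.
  by move/conj_w; rewrite /root gE => /eqP.
have aR_gt0 : 0 < a%:~R :> R by rewrite ltr0z.
have sumE : a%:~R * (w + w') = - b%:~R :> R.
  have nz : w - w' != 0 by rewrite subr_eq0 eq_sym.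
  by apply: (mulIf nz); lra.
have eqDR : D%:R = (a%:~R * (w - w')) ^+ 2 :> R.
  have -> : D%:R = (D%:Z)%:~R :> R by [].
  rewrite eqD expr2 intrB !intrM.
  have bE : b%:~R = - (a%:~R * (w + w')) :> R by rewrite sumE opprK.
  have -> : c%:~R = - (a%:~R * w ^+ 2) - b%:~R * w :> R by lra.
  by rewrite bE; ring.
have sqrtE : Num.sqrt D%:R = a%:~R * (w - w') :> R.
  by rewrite eqDR sqrtr_sqr ger0_norm // mulr_ge0 ?ltW //; lra.
have sqrt_le : Num.sqrt D%:R <= D%:R :> R.
  case: (D) => [|n]; first by rewrite sqrtr0.
  rewrite -[leRHS]normr_nat -sqrtr_sqr ler_sqrt ?exprn_ge0//.
  by rewrite -natrX ler_nat -mulnn leq_pmulr.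
case: a eq_w a_gt0 eqD eq_w' aR_gt0 sumE eqDR sqrtE => // a _ _ _ _.
case: b => [b|b]; rewrite ?NegzE ?mulrNz -!pmulrn => a0 sumE _ sqrtE.
  have : 0 <= b%:R :> R by [].
  rewrite -[b%:R]opprK -sumE oppr_ge0 pmulr_rle0//; nra.
rewrite opprK in sumE.
have aD : (a < D.+1)%N.
  rewrite ltnS -(ler_nat R); apply: le_trans sqrt_le; rewrite sqrtE; nra.
have bD : (b.+1 < D.+1)%N.
  rewrite ltnS -(ler_nat R); apply: le_trans sqrt_le; rewrite sqrtE -sumE; nra.
exists (Ordinal aD, Ordinal bD) => //.
rewrite /f /= sqrtE -sumE; field.
by rewrite gt_eqF.
Qed.

(* [fset_set] is empty on infinite sets; [finite_reduced_disc] rules that out. *)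
Definition kappa (R : realType) (D : nat) : nat :=
  #|` fset_set (@reduced_disc R D)|.

(* Main.v *)
(** A reduced number w of discriminant 4N is (k + sqrt N) / a for a triple
    (a, k, c) of positive integers with k^2 + ac = N and |a - c| < 2k; for
    N = p and N = 2p every such triple is primitive. The involution
    sigma : w |-> -1/w' exchanges a and c. The involution
    rho : w |-> floor w - w' fixes a. A genus character chi separates the
    triples into two halves; sigma exchanges the halves and rho preserves
    them, since w |-> 1/(w - floor w) turns a form into the negative of an
    equivalent one. So kappa(4N) is twice the size of the half chi = 1, whose
    parity is that of the number of fixed points of rho in it. A fixed point
    has a | 2k, hence a = 1 or a = 2, and each of these a occurs exactly once.
    The one with a = 1 satisfies chi = 1, and the one with a = 2 satisfies
    chi = 1 iff p = 7 mod 8 (i.e. iff x^2 - N y^2 represents 2 rather than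
    -2). *)
Require Import Defs.
From mathcomp Require Import all_boot all_order all_algebra.
From mathcomp Require Import finmap zify ring lra.
From mathcomp Require Import boolp classical_sets cardinality reals.

Set Implicit Arguments.
Unset Strict Implicit.
Unset Printing Implicit Defensive.
Local Open Scope fset_scope.
Local Open Scope nat_scope.

(** * Parity of finite sets with an involution *)

Lemma fixfree_involution_even (T : choiceType) (f : T -> T) (A : {fset T}) :
    {in A, forall x, f x \in A} -> {in A, involutive f} ->
    {in A, forall x, f x != x} ->
  ~~ odd #|` A|.
Proof.
have [n] := ubnP #|` A|; elim: n A => // n IHn A leAn fA fK fx.
have [->|/fset0Pn[x Ax]] := eqVneq A fset0; first by rewrite cardfs0.
have Afx := fA x Ax; have nfx := fx x Ax.
have cardA : #|` A| = #|` A `\ x `\ f x|.+2.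
  by rewrite (cardfsD1 x) Ax (cardfsD1 (f x)) !inE nfx Afx.
rewrite cardA /= negbK IHn // => [|y|y|y].
- by rewrite cardA in leAn; apply: ltnW.
- rewrite !inE => /and3P[yfx yx Ay]; rewrite fA // andbT; apply/andP; split.
    by apply: contra yx => /eqP/(congr1 f); rewrite !fK // => ->.
  by apply: contra yfx => /eqP <-; rewrite fK.
- by rewrite !inE => /and3P[_ _ /fK].
- by rewrite !inE => /and3P[_ _ /fx].
Qed.

(** The complement of the fixed points is stable under [f] and splits into pairs. *)
Lemma odd_card_fixed (T : choiceType) (f : T -> T) (A : {fset T}) :
    {in A, forall x, f x \in A} -> {in A, involutive f} ->
  odd #|` A| = odd #|` [fset x in A | f x == x]|.
Proof.
move=> fA fK; set B := [fset x in A | _].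
rewrite -(cardfsID B A) oddD.
have -> : (A `&` B) = B.
  by apply/fsetP => x; rewrite !inE /= andbA andbb.
suff /negPf-> : ~~ odd #|` A `\` B| by rewrite addbF.
apply: (@fixfree_involution_even _ f) => x;
  rewrite !inE /=; case Ax: (x \in A); rewrite ?andbF ?andbT //=.
- by move=> nfx; rewrite fA // fK // eq_sym (negPf nfx) andbF.
- by move=> _; apply: fK.
Qed.

(** * Triples attached to reduced numbers *)

(* The triple [(a, k, c)] stands for the form a X^2 - 2 k X - c of discriminant
   4N, whose positive root is (k + sqrt N) / a; the two strict inequalities say
   that this root is reduced. *)
Definition is_form N (x : nat * nat * nat) : bool :=
  let: (a, k, c) := x in
  [&& 0 < a, 0 < c, k ^ 2 + a * c == N, a < c + 2 * k & c < a + 2 * k].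

Arguments is_form : simpl never.

Definition triples N : seq (nat * nat * nat) :=
  let r := iota 0 N.+1 in
  [seq (y, c) | y <- [seq (a, k) | a <- r, k <- r], c <- r].

Definition forms N : {fset nat * nat * nat} := [fset x in triples N | is_form N x].

Lemma in_forms N x : (x \in forms N) = is_form N x.
Proof.
have : is_form N x -> x \in triples N.
  case: x => [[a k] c] /and5P[a0 c0 /eqP eN _ _].
  apply/allpairsP; exists ((a, k), c); split=> //; last by rewrite mem_iota /=; nia.
  apply/allpairsP; exists (a, k); split=> //; rewrite mem_iota /=; nia.
rewrite /forms; move: (triples N) => S xS; rewrite !inE /=.
by case F: (is_form N x); rewrite ?andbF // xS.
Qed.

Lemma is_form_inj N a k c c' :
  is_form N (a, k, c) -> is_form N (a, k, c') -> c = c'.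
Proof.
move=> /and5P[a0 _ /eqP e _ _] /and5P[_ _ /eqP e' _ _].
by apply/eqP; rewrite -(eqn_pmul2l a0); lia.
Qed.

(** * The involution [rho] *)

Section Rho.
Variables (N s : nat).
Hypothesis sN : s ^ 2 < N < s.+1 ^ 2.

(** Multiplying by a turns a < c + 2k into (a - k)^2 < N and c < a + 2k into N < (a + k)^2; as s =
    floor (sqrt N), these are linear bounds in s. *)
Lemma is_formE a k c :
  is_form N (a, k, c) =
  [&& k ^ 2 + a * c == N, k <= s, s < a + k & a <= k + s].
Proof.
have [s1 s2] := andP sN.
apply/and5P/and4P => [[a0 c0 /eqP e h1 h2]|[/eqP e h1 h2 h3]]; split=> //;
  try exact/eqP; nia.
Qed.

(* Here s = floor (sqrt N), so that n = floor w for w = (k + sqrt N) / a, and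
   rho is w |-> floor w - w'. *)
Definition rho (x : nat * nat * nat) :=
  let: (a, k, c) := x in
  let n := (k + s) %/ a in
  (a, n * a - k, c + 2 * n * k - n ^ 2 * a).

(** With r the remainder of k + s modulo a, na - k = s - r. The two inequalities rule out truncated
    subtraction in [rho]; the unchanged quotient n makes [rho] an involution. *)
Lemma rho_spec a k c (n := (k + s) %/ a) : is_form N (a, k, c) ->
  [/\ k <= n * a, n ^ 2 * a < c + 2 * n * k,
      is_form N (rho (a, k, c)) & (n * a - k + s) %/ a = n].
Proof.
have [s1 s2] := andP sN.
rewrite is_formE => /and4P[/eqP e h1 h2 h3].
have a0 : 0 < a by nia.
have := divn_eq (k + s) a; have := ltn_pmod (k + s) a0.
rewrite -/n; set r := _ %% _ => ra en.
have n1 : s < a -> n = 1.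
  move=> sa; apply/eqP; rewrite eqn_leq divn_gt0 // h3 andbT -ltnS.
  by rewrite ltn_divLR //; lia.
have rs : r <= s by have [|/n1] := leqP a s; lia.
have kn : k <= n * a by lia.
have k'E : n * a - k = s - r by lia.
(* The equation of the image triple, with its negative term moved to the left. *)
have eqN : a * (n ^ 2 * a) + N = (n * a - k) ^ 2 + a * (c + 2 * n * k).
  have -> : a * (n ^ 2 * a) = (n * a) ^ 2 by ring.
  have -> : a * (c + 2 * n * k) = a * c + 2 * k * (n * a) by ring.
  by rewrite -e -(subnK kn) addnK; ring.
have cn : n ^ 2 * a < c + 2 * n * k.
  have : (s - r) ^ 2 <= s ^ 2 by rewrite leq_sqr; lia.
  by rewrite -(ltn_pmul2l a0) -k'E; lia.
split=> //; last first.
  have -> : n * a - k + s = n * a + (s - k) by lia.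
  rewrite divnMDl // divn_small ?addn0 //; lia.
rewrite /rho -/n is_formE; apply/and4P.
split; [|lia|by have [|/n1] := leqP a s; lia..].
apply/eqP; rewrite mulnBr; have : a * (n ^ 2 * a) < a * (c + 2 * n * k).
  by rewrite ltn_pmul2l.
lia.
Qed.

Lemma rho_form x : is_form N x -> is_form N (rho x).
Proof. by case: x => [[a k] c] /rho_spec[]. Qed.

Lemma rhoK x : is_form N x -> rho (rho x) = x.
Proof.
case: x => [[a k] c] F; have [k1 _ F1 e] := rho_spec F.
have := rho_form F1; rewrite [in X in X -> _]/rho /rho e.
set n := _ %/ _ in k1 *.
rewrite (subKn k1) => F2.
by rewrite (is_form_inj F2 F).
Qed.

Lemma rho_fixedP a k c : is_form N (a, k, c) ->
  reflect (((k + s) %/ a) * a = 2 * k) (rho (a, k, c) == (a, k, c)).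
Proof.
move=> F; have [k1 _ F1 _] := rho_spec F.
apply: (iffP eqP) => [[e _]|e]; first lia.
have F2 := rho_form F; move: F2; rewrite /rho.
have -> : ((k + s) %/ a) * a - k = k by lia.
by move=> F2; rewrite (is_form_inj F2 F).
Qed.

End Rho.

(** * Counting triples modulo 4 with an abstract character *)

Section Count.
Variables (N s : nat) (chi : pred (nat * nat * nat)) (e : bool).
Hypothesis sN : s ^ 2 < N < s.+1 ^ 2.
Hypothesis N2 : 2 < N.
Hypothesis chi_swap : forall a k c, is_form N (a, k, c) ->
  chi (c, k, a) = ~~ chi (a, k, c).
Hypothesis chi_rho : forall x, is_form N x -> chi (rho s x) = chi x.
Hypothesis ambiguous : forall a k c, is_form N (a, k, c) -> a %| 2 * k -> a <= 2.
Hypothesis chi1 : forall k c, is_form N (1, k, c) -> chi (1, k, c).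
Hypothesis chi2 : forall k c, is_form N (2, k, c) -> chi (2, k, c) = e.

Lemma is_form_swap a k c : is_form N (a, k, c) = is_form N (c, k, a).
Proof. by rewrite /is_form (mulnC a); apply/and5P/and5P => -[]. Qed.

Lemma card_forms_chi :
  #|` forms N| = #|` [fset x in forms N | chi x]|.*2.
Proof.
set A := [fset x in forms N | chi x].
rewrite -(cardfsID A) -addnn; congr (_ + _).
  by congr (#|` _|); apply/fsetP => x; rewrite !inE /= andbA andbb.
pose f (x : nat * nat * nat) := (x.2, x.1.2, x.1.1).
have -> : (forms N `\` A) = [fset f x | x in A].
  apply/fsetP => -[[a k] c]; rewrite in_fsetD in_forms.
  apply/andP/imfsetP => [[]|[[[a' k'] c'] /=]].
    rewrite !in_fset /= inE /= in_forms => + F; rewrite F /= => nchi.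
    exists (c, k, a) => //=.
    by rewrite in_fset /= inE /= in_forms -is_form_swap F chi_swap.
  rewrite in_fset /= inE /= in_forms => /andP[F ch] [-> -> ->].
  rewrite in_fset /= inE /= in_forms is_form_swap F; split=> //=.
  by rewrite chi_swap // ch.
by rewrite card_imfset //= => -[[a k] c] [[a' k'] c'] [-> -> ->].
Qed.

(** Modulo 2, the half [chi] counts the fixed points of [rho] in it: one with a = 1, and one with a
    = 2 exactly when [e] holds. *)
Lemma card_forms_mod4 : #|` forms N| = 2 * e.+1 %[mod 4].
Proof.
have [s1 s2] := andP sN.
rewrite card_forms_chi; set A := [fset x in _ | _].
have inA x : (x \in A) = is_form N x && chi x.
  by rewrite in_fset /= inE /= in_forms.
suff oA : odd #|` A| = ~~ e by rewrite -muln2; move: oA; lia.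
rewrite (@odd_card_fixed _ (rho s)); last 2 first.
- by move=> x; rewrite !inA => /andP[F ch]; rewrite rho_form //= chi_rho.
- by move=> x; rewrite inA => /andP[F _]; apply: (rhoK sN).
(* By [is_formE], a = 1 forces k = s, and a = 2 forces s - 1 <= k <= s; then 2c = N - k^2 fixes the
   parity of k, which selects [k2]. *)
pose k2 := s - (N + s) %% 2.
pose x1 := (1, s, N - s ^ 2); pose x2 := (2, k2, (N - k2 ^ 2) %/ 2).
have F1 : is_form N x1 by rewrite (is_formE sN); apply/and4P; split; nia.
have s_gt0 : 0 < s by nia.
have k2s : k2 <= s by rewrite /k2; lia.
have k2N : k2 ^ 2 + 2 * ((N - k2 ^ 2) %/ 2) = N.
  have : k2 ^ 2 <= s ^ 2 by rewrite leq_sqr.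
  have : (k2 ^ 2) %% 2 = k2 %% 2 by rewrite modn2 oddX /= -modn2.
  rewrite /k2 -/k2; lia.
have F2 : is_form N x2.
  rewrite (is_formE sN) k2N eqxx k2s /=.
  (* The bound 2 <= k2 + s is in doubt only for s = 1, where N = 3 and [k2] is 1. *)
  have [s_eq1|] : s = 1 \/ 1 < s by lia.
    by move: k2N s2 k2s; rewrite /k2 s_eq1; lia.
  by rewrite /k2; lia.
have fixed a k c : is_form N (a, k, c) -> rho s (a, k, c) = (a, k, c) ->
    (a, k, c) = x1 \/ (a, k, c) = x2.
  move=> F /eqP/(rho_fixedP sN F) fx.
  have : a %| 2 * k by rewrite -fx dvdn_mull.
  move/(ambiguous F) => a2; have a0 : 0 < a by case/and5P: F.
  have := F; rewrite (is_formE sN) => /and4P[/eqP eN ks sk _].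
  have {a0 a2} [a1|a2] : a = 1 \/ a = 2 by lia.
    left; subst a; have ks' : k = s by lia.
    by rewrite /x1 -ks'; congr (_, _); lia.
  right; subst a; have kk : k = k2.
    have : (k ^ 2) %% 2 = k %% 2 by rewrite modn2 oddX /= -modn2.
    by rewrite /k2; lia.
  by rewrite /x2 -kk; congr (_, _); lia.
have -> : [fset x in A | rho s x == x]
     = (if e then [fset x1; x2] else [fset x1]).
  apply/fsetP => x.
  have -> : (x \in (if e then [fset x1; x2] else [fset x1]))
    = (x == x1) || e && (x == x2).
    by case: (e); rewrite !inE ?orbF.
  rewrite in_fset /= inE /= inA; apply/andP/orP.
    case: x => [[a k] c] [/andP[F ch] /eqP fx].
    have [->|xE] := fixed _ _ _ F fx; first by left.
    by right; rewrite xE eqxx andbT -(chi2 F2) -/x2 -xE.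
  case=> [/eqP ->|/andP[ee /eqP ->]].
    rewrite F1 chi1 //; split=> //; apply/(rho_fixedP sN F1).
    by rewrite divn1; lia.
  (* Since s - k2 <= 1, the quotient of k2 + s by 2 is [k2]. *)
  rewrite F2 chi2 //; split=> //; apply/(rho_fixedP sN F2).
  by rewrite /k2; lia.
by case: (e); rewrite ?cardfs1 // cardfs2.
Qed.

End Count.

(** * Genus characters modulo 8 *)

(* The genus character, read off from an odd value a or -c of the form (7 * c
   stands for -c). G consists of the residues n modulo 8 at which the character
   is 1: it is (-1/n), G = {1, 5}, for N = p, and (-2/n), G = {1, 3}, for
   N = 2p. *)
Definition genus (G : seq nat) (x : nat * nat * nat) : bool :=
  let: (a, k, c) := x in (a %% 8 \in G) || ((7 * c) %% 8 \in G).

(* Modulo 8, rho replaces c by c + 2nk + 7n^2 a. *)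
Definition is_genus_mod8 G r :=
  let i8 := iota 0 8 in
  all (fun a => all (fun k => all (fun c => ((k ^ 2 + a * c) %% 8 == r) ==>
    (genus G (c, k, a) == ~~ genus G (a, k, c)) &&
    all (fun n => genus G (a, k, c + 2 * n * k + 7 * n ^ 2 * a)
                    == genus G (a, k, c)) i8) i8) i8) i8.

Lemma eq_genus G a a' k k' c c' : a = a' %[mod 8] -> c = c' %[mod 8] ->
  genus G (a, k, c) = genus G (a', k', c').
Proof. by move=> ea ec; rewrite /genus ea -modnMmr ec modnMmr. Qed.

Section Genus.
Variables (N : nat) (G : seq nat).
Hypothesis GN : is_genus_mod8 G (N %% 8).

(** Both claims depend only on residues modulo 8, where [GN] has checked every case. *)
Lemma genus_step a k c n : k ^ 2 + a * c = N ->
  genus G (c, k, a) = ~~ genus G (a, k, c) /\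
  genus G (a, k, c + 2 * n * k + 7 * n ^ 2 * a) = genus G (a, k, c).
Proof.
move=> eN; have m8 m : m %% 8 \in iota 0 8 by rewrite mem_iota /= ltn_mod.
have := GN; rewrite /is_genus_mod8.
move=> /allP/(_ _ (m8 a))/allP/(_ _ (m8 k))/allP/(_ _ (m8 c)).
rewrite -[in X in X -> _]modnDm modnXm modnMm modnDm eN eqxx implyTb.
move=> /andP[/eqP h1 /allP/(_ _ (m8 n))/eqP h2]; split.
  rewrite (@eq_genus G a (a %% 8) _ (k %% 8) c (c %% 8)) ?modn_mod // -h1.
  by apply: eq_genus; rewrite modn_mod.
rewrite (@eq_genus G a (a %% 8) k (k %% 8) c (c %% 8)) ?modn_mod // -h2.
have cD x x' y y' : x = x' %[mod 8] -> y = y' %[mod 8] -> x + y = x' + y' %[mod 8].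
  by move=> ex ey; rewrite -modnDm ex ey modnDm.
have cM x x' y y' : x = x' %[mod 8] -> y = y' %[mod 8] -> x * y = x' * y' %[mod 8].
  by move=> ex ey; rewrite -modnMm ex ey modnMm.
apply: eq_genus; first by rewrite modn_mod.
have m x : x = x %% 8 %[mod 8] by rewrite modn_mod.
have m2 x : x ^ 2 = (x %% 8) ^ 2 %[mod 8] by rewrite modnXm.
apply: (cD); last exact: (cM _ _ _ _ (cM _ _ _ _ erefl (m2 n)) (m a)).
exact: cD (m c) (cM _ _ _ _ (cM _ _ _ _ erefl (m n)) (m k)).
Qed.

Lemma genus_rho s x : s ^ 2 < N < s.+1 ^ 2 ->
  is_form N x -> genus G (rho s x) = genus G x.
Proof.
case: x => [[a k] c] sN F; have [_ lt _ _] := rho_spec sN F.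
have [_ _ /eqP eN _ _] := and5P F.
have [_ <-] := genus_step ((k + s) %/ a) eN.
rewrite /rho /genus; set n := _ %/ _ in lt *.
(* The subtraction is exact by [lt], and -1 = 7 modulo 8. *)
suff -> : (7 * (c + 2 * n * k - n ^ 2 * a)) %% 8 =
  (7 * (c + 2 * n * k + 7 * n ^ 2 * a)) %% 8 by [].
move: lt; rewrite -(mulnA 7); move: (n ^ 2 * a) (2 * n * k); lia.
Qed.

End Genus.

(** * Divisibility in triples for N = p and N = 2p *)

Section TwicePrime.
Variables (p N : nat).
Hypotheses (p_pr : prime p) (p_odd : odd p).
Hypotheses (Np : N = p \/ N = 2 * p) (N4 : 2 <= N %% 4).

(** The exponent of p in N is 1, while in a square it is even. *)
Lemma twice_prime_nonsquare m : m ^ 2 <> N.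
Proof.
move=> mN; have := congr1 (odd \o logn p) mN; rewrite /= lognX oddM /=.
case: Np => ->; first by rewrite (pfactorK 1).
by rewrite lognM ?prime_gt0 // (pfactorK 1) // logn_coprime // coprimen2.
Qed.

(** Such a d divides N, hence p; and d = p is excluded by 0 < k < p, since k^2 < 2p <= p^2. *)
Lemma form_odd_dvd a k c d :
  is_form N (a, k, c) -> odd d -> d %| a -> d %| k -> d = 1.
Proof.
move=> /and5P[a0 c0 /eqP eN h1 h2] d_odd da dk.
have p1 := prime_gt1 p_pr.
have k0 : 0 < k by lia.
have kp : k < p by nia.
have dN : d %| N by rewrite -eN dvdn_add ?dvdn_mulr // expnS dvdn_mulr.
have : d %| p.
  case: Np dN => -> //; rewrite Gauss_dvdr // coprime_sym coprime2n //.
move/primeP: p_pr => [_ pP] /pP/orP[/eqP //|/eqP dp].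
by have := dvdn_leq k0 dk; rewrite dp leqNgt kp.
Qed.

(** A square is 0 or 1 modulo 4, whereas N is 2 or 3. *)
Lemma form_ndvd4 a k c : is_form N (a, k, c) -> ~~ (4 %| a * c).
Proof.
move=> /and5P[_ _ /eqP eN _ _]; apply: contraL N4 => /dvdnP[q qE].
rewrite -eN qE addnC modnMDl -modnXm; have : k %% 4 < 4 by rewrite ltn_mod.
by case: (k %% 4) => [|[|[|[]]]].
Qed.

Lemma form_primitive a k c :
  is_form N (a, k, c) -> gcdn (gcdn a (2 * k)) c = 1.
Proof.
move=> F; set d := gcdn _ _.
have da : d %| a by rewrite (dvdn_trans (dvdn_gcdl _ _)) ?dvdn_gcdl.
have dk : d %| 2 * k by rewrite (dvdn_trans (dvdn_gcdl _ _)) ?dvdn_gcdr.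
have dc : d %| c by rewrite dvdn_gcdr.
have d_odd : odd d.
  apply: contraR (form_ndvd4 F) => de; have d2 : 2 %| d by rewrite dvdn2.
  by apply: (@dvdn_mul 2 2); apply: dvdn_trans d2 _.
apply: (form_odd_dvd F d_odd da).
by move: dk; rewrite Gauss_dvdr // coprime_sym coprime2n.
Qed.

(** The odd part of a divides k, so it is 1; and 4 does not divide a. *)
Lemma form_ambiguous a k c : is_form N (a, k, c) -> a %| 2 * k -> a <= 2.
Proof.
move=> F ak; have [ao|ae] := boolP (odd a).
  rewrite (form_odd_dvd F ao) // -(@Gauss_dvdr a 2) //.
  by rewrite coprime_sym coprime2n.
have [b aE] : exists b, a = 2 * b by exists a./2; lia.
have bo : odd b.
  apply: contraR (form_ndvd4 F) => be; rewrite aE dvdn_mulr //.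
  by rewrite (@dvdn_pmul2l 2 2) // dvdn2.
rewrite aE (form_odd_dvd F bo) // ?aE ?dvdn_mull //.
by move: ak; rewrite aE dvdn_pmul2l.
Qed.

End TwicePrime.

Lemma is_genus_p N : N = 3 %[mod 4] -> is_genus_mod8 [:: 1; 5] (N %% 8).
Proof.
by move=> N4; have [->|->] : N %% 8 = 3 \/ N %% 8 = 7 by lia.
Qed.

Lemma is_genus_2p N : N = 6 %[mod 8] -> is_genus_mod8 [:: 1; 3] (N %% 8).
Proof. by move=> ->. Qed.

(** Here k is odd, so k^2 = 1 modulo 8 and -c = (1 - p) / 2 modulo 4. *)
Lemma genus2_p p k c : p = 3 %[mod 4] -> k ^ 2 + 2 * c = p ->
  genus [:: 1; 5] (2, k, c) = (p %% 8 == 7).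
Proof.
move=> p4 e; rewrite /genus !inE /=.
have : k %% 8 < 8 by rewrite ltn_mod.
have : (k ^ 2) %% 8 = ((k %% 8) ^ 2) %% 8 by rewrite modnXm.
by case: (k %% 8) => [|[|[|[|[|[|[|[|//]]]]]]]] /=; lia.
Qed.

(** Here k = 2j and -c = 2j^2 - p, with 2j^2 equal to 0 or 2 modulo 8. *)
Lemma genus2_2p p k c : p = 3 %[mod 4] -> k ^ 2 + 2 * c = 2 * p ->
  genus [:: 1; 3] (2, k, c) = (p %% 8 == 7).
Proof.
move=> p4 e; rewrite /genus !inE /=.
have [j kE] : exists j, k = 2 * j.
  exists k./2; have : (k ^ 2) %% 2 = k %% 2 by rewrite modn2 oddX /= -modn2.
  lia.
have {}e : 2 * j ^ 2 + c = p by move: e; rewrite kE; lia.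
have : j %% 8 < 8 by rewrite ltn_mod.
have : (j ^ 2) %% 8 = ((j %% 8) ^ 2) %% 8 by rewrite modnXm.
by case: (j %% 8) => [|[|[|[|[|[|[|[|//]]]]]]]] /=; lia.
Qed.

(** * Quadratic irrationals and their conjugates *)

Section RealQuadratic.
Import Order.TTheory GRing.Theory Num.Theory.
Local Open Scope ring_scope.

Lemma irrational_sqrt (R : realType) (N : nat) :
  (forall m, (m ^ 2)%N <> N) -> irrational (Num.sqrt N%:R : R).
Proof.
move=> nsq [q _ qE].
have q2 : q ^+ 2 = N%:R.
  apply: (fmorph_inj (@ratr R)).
  by rewrite rmorphXn /= qE sqr_sqrtr ?ler0n // rmorph_nat.
have dq0 : denq q != 0 := denq_neq0 q.
have e : numq q ^+ 2 = N%:Z * denq q ^+ 2.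
  apply: (intr_inj (R := rat)).
  by rewrite rmorphXn /= numqE exprMn q2 [RHS]rmorphM rmorphXn.
have en : (`|numq q| ^ 2 = N * `|denq q| ^ 2)%N.
  by have := congr1 absz e; rewrite abszM !abszX.
have d1 : `|denq q|%N = 1%N.
  have : (`|denq q| ^ 2 %| `|numq q| ^ 2)%N by rewrite en dvdn_mull.
  rewrite dvdn_pexp2r // => /gcdn_idPr <-.
  by apply/eqP; exact: coprime_num_den.
by apply: (nsq `|numq q|%N); rewrite en d1 muln1.
Qed.

Lemma irrational_lin (R : realType) (z : R) (u v : rat) : irrational z ->
  ratr u + ratr v * z = 0 -> v = 0 /\ u = 0.
Proof.
move=> zi e; have v0 : v = 0.
  apply: contrapT => /eqP v0; apply: zi; exists (- u / v) => //.
  have v0' : ratr v != 0 :> R by rewrite fmorph_eq0.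
  rewrite rmorphM rmorphN fmorphV; apply: (mulIf v0').
  by rewrite divfK //; lra.
split=> //; move: e; rewrite v0 rmorph0 mul0r addr0 => /eqP.
by rewrite fmorph_eq0 => /eqP.
Qed.

Definition qpoly (a b c : int) : {poly int} :=
  a *: 'X^2 + b *: 'X + c%:P.

Lemma horner_qpoly (R : realType) a b c (x : R) :
  (map_poly intr (qpoly a b c)).[x] = a%:~R * x ^+ 2 + b%:~R * x + c%:~R.
Proof.
by rewrite !rmorphD /= !map_polyZ /= map_polyXn map_polyX map_polyC /= !hornerE.
Qed.

Lemma size_qpoly a b c : a != 0 -> size (qpoly a b c) = 3%N.
Proof.
move=> a0; rewrite /qpoly -addrA size_polyDl size_scale ?size_polyXn //.
rewrite (leq_ltn_trans (size_polyD _ _)) // gtn_max.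
rewrite (leq_ltn_trans (size_scale_leq _ _)) ?size_polyX //.
by rewrite (leq_ltn_trans (size_polyC_leq1 _)).
Qed.

Lemma map_qpoly_rat (R : realType) a b c :
  map_poly (@ratr R) (map_poly intr (qpoly a b c)) = map_poly intr (qpoly a b c).
Proof. by rewrite -map_poly_comp; apply: eq_map_poly => x /=; rewrite ratr_int. Qed.

(** The remainder of [f] modulo the quadratic has degree at most 1 and vanishes at the irrational
    [w], so it is zero. *)
Lemma conjugate_qpoly (R : realType) a b c (w w' : R) :
  irrational w -> a != 0 -> w' != w ->
  root (map_poly intr (qpoly a b c)) w -> root (map_poly intr (qpoly a b c)) w' ->
  conjugate w w'.
Proof.
move=> wi a0 ww' rw rw'; split=> // f.
pose g : {poly rat} := map_poly intr (qpoly a b c).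
have sg : size g = 3%N.
  rewrite size_map_poly_id0 ?size_qpoly //.
  by rewrite intr_eq0 lead_coef_eq0 -size_poly_eq0 size_qpoly.
have g0 : g != 0 by rewrite -size_poly_eq0 sg.
rewrite (divp_eq f g) rmorphD rmorphM /= /root !hornerD !hornerM.
rewrite !(map_qpoly_rat R) (eqP rw) (eqP rw') !mulr0 !add0r.
have : (size (f %% g)%R < 3)%N by rewrite -sg ltn_modp.
have key (r : {poly rat}) : (size r < 3)%N ->
    (map_poly ratr r).[w] == 0 -> (map_poly ratr r).[w'] == 0; last exact: key.
move=> sr; have rE : r = (r`_0)%:P + r`_1 *: 'X.
  apply/polyP => -[|[|i]]; rewrite !coefE ?mulr0 ?mulr1 ?addr0 ?add0r //=.
  by rewrite nth_default // (leq_trans (_ : size r <= 2)%N).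
rewrite rE rmorphD /= map_polyZ /= map_polyX map_polyC /= !hornerE => /eqP e.
by have [-> ->] := irrational_lin wi e; rewrite !rmorph0 mul0r addr0.
Qed.

Lemma conjugate_root (R : realType) a b c (w w' : R) : conjugate w w' ->
  a%:~R * w ^+ 2 + b%:~R * w + c%:~R = 0 ->
  a%:~R * w' ^+ 2 + b%:~R * w' + c%:~R = 0.
Proof.
move=> [_ +] e => /(_ (map_poly intr (qpoly a b c))).
by rewrite !(map_qpoly_rat R) /root !horner_qpoly e eqxx => /(_ isT)/eqP.
Qed.

(** * Bijection between triples and reduced numbers of discriminant 4N *)

Section Kappa.
Variables (R : realType) (N : nat).
Hypothesis nsq : forall m, (m ^ 2)%N <> N.
Hypothesis prim : forall a k c, is_form N (a, k, c) ->
  gcdn (gcdn a (2 * k)) c = 1%N.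

Let r : R := Num.sqrt N%:R.

Definition form_root (x : nat * nat * nat) : R :=
  let: (a, k, c) := x in (k%:R + r) / a%:R.

Let r2 : r ^+ 2 = N%:R. Proof. by rewrite sqr_sqrtr ?ler0n. Qed.
Let r_ge0 : 0 <= r. Proof. exact: sqrtr_ge0. Qed.

(** Clearing denominators and comparing coefficients of 1 and sqrt N gives a and k; then c
    follows. *)
Lemma form_root_inj : {in forms N &, injective form_root}.
Proof.
move=> [[a k] c] [[a' k'] c']; rewrite !in_forms => F F' /= e.
have [a0 _ /eqP eN _ _] := and5P F; have [a0' _ /eqP eN' _ _] := and5P F'.
have {}e : ratr (k%:R * a'%:R - k'%:R * a%:R) + ratr (a'%:R - a%:R) * r = 0.
  rewrite !rmorphB !rmorphM /= !ratr_nat.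
  have A0 : a%:R != 0 :> R by rewrite pnatr_eq0; lia.
  have A0' : a'%:R != 0 :> R by rewrite pnatr_eq0; lia.
  have : (k%:R + r) / a%:R * (a%:R * a'%:R) = (k'%:R + r) / a'%:R * (a%:R * a'%:R).
    by rewrite e.
  rewrite mulrA divfK // [in RHS](mulrC a%:R) mulrA divfK // => h; lra.
have [/eqP + /eqP] := irrational_lin (irrational_sqrt nsq) e.
rewrite !subr_eq0 -!natrM !eqr_nat => /eqP aE; subst a'.
rewrite eqn_pmul2r // => /eqP kE; subst k'.
by rewrite (is_form_inj F F').
Qed.

Lemma form_rootP x : is_form N x -> reduced_disc (4 * N) (form_root x).
Proof.
case: x => [[a k] c] F; have [a0 c0 /eqP eN h1 h2] := and5P F.
pose A : int := a; pose B : int := - (2 * k)%:Z; pose C : int := - c%:Z.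
have A0 : A != 0 by rewrite eqz_nat -lt0n.
have dE : (4 * N)%:Z = B ^+ 2 - 4 * A * C.
  by rewrite /A /B /C -eN; clear; lia.
have a0R : 0 < a%:R :> R by rewrite ltr0n.
have c0R : 0 < c%:R :> R by rewrite ltr0n.
have eNR : k%:R ^+ 2 + a%:R * c%:R = r ^+ 2 by rewrite r2 -eN natrD natrM natrX.
have h1R : a%:R < c%:R + 2 * k%:R :> R by rewrite -natrM -natrD ltr_nat.
have h2R : c%:R < a%:R + 2 * k%:R :> R by rewrite -natrM -natrD ltr_nat.
have k0R : 0 <= k%:R :> R by rewrite ler0n.
set w := form_root _; pose w' : R := (k%:R - r) / a%:R.
have wi : irrational w.
  move=> [q _ qE]; apply: (irrational_sqrt (R := R) nsq).
  exists (q * a%:R - k%:R) => //; rewrite rmorphB rmorphM /= !ratr_nat qE /w /=.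
  by rewrite divfK ?gt_eqF // addrC addKr.
have wE : w = (k%:R + r) / a%:R by [].
have ABC x : A%:~R * x ^+ 2 + B%:~R * x + C%:~R
  = a%:R * x ^+ 2 - 2 * k%:R * x - c%:R :> R.
  by rewrite /B /C !rmorphN /= -!pmulrn natrM !mulNr.
have a_neq0 : a%:R != 0 :> R by rewrite gt_eqF.
have rootE x : (x * a%:R - k%:R) ^+ 2 = r ^+ 2 ->
    A%:~R * x ^+ 2 + B%:~R * x + C%:~R = 0.
  by move=> h; rewrite ABC; apply: (mulfI a_neq0); rewrite mulr0; lra.
have ew : A%:~R * w ^+ 2 + B%:~R * w + C%:~R = 0.
  by apply: rootE; rewrite wE divfK // addrC addKr.
have ew' : A%:~R * w' ^+ 2 + B%:~R * w' + C%:~R = 0.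
  by apply: rootE; rewrite divfK // addrC addKr sqrrN.
have sqr_lt x y : 0 <= y -> x ^+ 2 < y ^+ 2 -> x < y :> R.
  move=> y0 xy; rewrite ltNge; apply/negP => yx; move: xy.
  by rewrite ltNge ler_sqr ?nnegrE // ?yx // (le_trans y0).
(* The next three bounds express w' < 0, w > 1 and -1 < w', in this order. *)
have r_gt : k%:R < r.
  by apply: sqr_lt => //; rewrite -eNR ltrDl mulr_gt0.
have r_gta : a%:R - k%:R < r.
  apply: sqr_lt => //; have : 0 < a%:R * (c%:R + 2 * k%:R - a%:R) :> R.
    by rewrite mulr_gt0 // subr_gt0.
  rewrite -eNR; lra.
have r_lta : r < a%:R + k%:R.
  apply: sqr_lt; first lra.
  have : 0 < a%:R * (a%:R + 2 * k%:R - c%:R) :> R.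
    by rewrite mulr_gt0 // subr_gt0.
  rewrite -eNR; lra.
split.
- split=> //; exists (qpoly A B C); rewrite size_qpoly //; split=> //.
  by rewrite /root horner_qpoly ew.
- split; first by rewrite wE ltr_pdivlMr // mul1r; lra.
  exists w'; split; [|by rewrite ltr_pdivlMr //; lra
                     |by rewrite ltr_pdivrMr // mul0r; lra].
  apply: (@conjugate_qpoly _ A B C) => //.
  + rewrite wE (inj_eq (mulIf _)) ?invr_eq0 // lt_eqF //; lra.
  + by rewrite /root horner_qpoly ew.
  + by rewrite /root horner_qpoly ew'.
exists A, B, C; split=> //.
by rewrite /gcdz /= abszN /= prim // abszN.
Qed.

Lemma reduced_disc_form w :
  reduced_disc (4 * N) w -> exists2 x, is_form N x & w = form_root x.
Proof.
move=> [_ [w1 [w' [ww' w'1 w'0]]] [a [b [c [ew a0 _ dE]]]]].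
have ew' := conjugate_root ww' ew.
(* b is even because b^2 = 4N + 4ac. *)
have [m bE] : exists m, b = - (2 * m).
  exists (- (b %/ 2)%Z); nia.
subst b.
have a0R : 0 < a%:~R :> R by rewrite ltr0z.
have sE : a%:~R * (w + w') = 2 * m%:~R :> R.
  have nz : w' - w != 0 by rewrite subr_eq0; case: ww'.
  apply: (mulIf nz); move: ew ew'; rewrite rmorphN rmorphM /=; lra.
have pE : a%:~R * (w * w') = c%:~R :> R.
  move: ew; rewrite rmorphN rmorphM /= -sE; lra.
have m0 : 0 < m.
  rewrite -(ltr0z R); nra.
have c0 : c < 0.
  rewrite -(ltrz0 R) -pE !pmulr_rlt0 //; lra.
(* For f = aX^2 - 2mX + c, this is f(1) < 0, and the next one is f(-1) > 0. *)
have i1 : a < - c + 2 * m.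
  rewrite -(ltr_int R) rmorphD rmorphN rmorphM /= -sE -pE.
  have : 0 < a%:~R * ((w - 1) * (1 - w')) by rewrite !mulr_gt0 //; lra.
  lra.
have i2 : - c < a + 2 * m.
  rewrite -(ltr_int R) rmorphD rmorphN rmorphM /= -sE -pE.
  have : 0 < a%:~R * ((1 + w) * (1 + w')) by rewrite !mulr_gt0 //; lra.
  lra.
have eN : m ^+ 2 - a * c = N by lia.
exists (absz a, absz m, absz c).
  apply/and5P; split; try lia.
(* Both sides have square N, and the right one equals a(w - w')/2 > 0. *)
have rE : r = a%:~R * w - m%:~R.
  have : r ^+ 2 = (a%:~R * w - m%:~R) ^+ 2.
    have -> : r ^+ 2 = N%:Z%:~R by rewrite r2.
    rewrite -eN rmorphB rmorphXn rmorphM /= -pE.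
    have -> : m%:~R = a%:~R * (w + w') / 2 by rewrite sE; field.
    by field.
  move/eqP; rewrite eqrXn2 // => [/eqP //|].
  suff : 0 < a%:~R * (w - w') by lra.
  by rewrite mulr_gt0 //; lra.
rewrite /form_root rE.
have -> : (absz m)%:R = m%:~R :> R by rewrite natr_absz gtr0_norm.
have -> : (absz a)%:R = a%:~R :> R by rewrite natr_absz gtr0_norm.
by rewrite addrC subrK mulrC mulKf // gt_eqF.
Qed.

Lemma kappa_forms : kappa R (4 * N) = #|` forms N|.
Proof.
rewrite /kappa.
have -> : reduced_disc (R := R) (4 * N) = [set` [fset form_root x | x in forms N]]%classic.
  apply/seteqP; split=> w /=.
    move=> /reduced_disc_form[x F ->]; apply/imfsetP; exists x => //.
    by rewrite /= in_forms.
  by move=> /imfsetP[x /= + ->]; rewrite in_forms => /form_rootP.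
by rewrite set_fsetK card_in_imfset //; apply: form_root_inj.
Qed.

End Kappa.

End RealQuadratic.

(** * Assembly for N = p and N = 2p *)

Lemma sqrt_bounds N : exists s, s ^ 2 <= N < s.+1 ^ 2.
Proof.
elim: N => [|N [s /andP[h1 h2]]]; first by exists 0.
have [h|h] := ltnP N.+1 (s.+1 ^ 2); first by exists s; rewrite h leqW.
by exists s.+1; rewrite h; nia.
Qed.

Lemma kappa_mod4 (R : realType) p N G (e : bool) :
  prime p -> odd p -> N = p \/ N = 2 * p -> 2 <= N %% 4 ->
  is_genus_mod8 G (N %% 8) -> 1 \in G ->
  (forall k c, k ^ 2 + 2 * c = N -> genus G (2, k, c) = e) ->
  kappa R (4 * N) = 2 * e.+1 %[mod 4].
Proof.
move=> p_pr p_odd Np N4 GN G1 G2.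
have nsq := twice_prime_nonsquare p_pr p_odd Np.
have [s /andP[s1 s2]] := sqrt_bounds N.
have sN : s ^ 2 < N < s.+1 ^ 2.
  by rewrite s2 andbT ltn_neqAle s1 andbT; apply/eqP.
rewrite kappa_forms //; last exact: form_primitive p_pr p_odd Np N4.
apply: (@card_forms_mod4 _ s (genus G)) => //.
- by have := odd_prime_gt2 p_odd p_pr; case: Np => ->; lia.
- move=> a k c /and5P[_ _ /eqP eN _ _].
  by have [] := genus_step GN 0 eN.
- by move=> x; apply: genus_rho.
- exact: form_ambiguous p_pr p_odd Np N4.
- by move=> k c _; rewrite /genus G1.
- by move=> k c /and5P[_ _ /eqP eN _ _]; apply: G2.
Qed.

Theorem theorem3p6 (R : realType) (p : nat)
    (hp : prime p) (hp4 : p = 3 %[mod 4]) :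
  (p = 3 %[mod 8] ->
     kappa R (4 * p) = kappa R (8 * p) %[mod 4] /\
     kappa R (8 * p) = 2 %[mod 4]) /\
  (p = 7 %[mod 8] ->
     kappa R (4 * p) = kappa R (8 * p) %[mod 4] /\
     kappa R (8 * p) = 0 %[mod 4]).
Proof.
have p_odd : odd p by lia.
(* The right-hand side is 2 when p = 3 modulo 8 and 4 when p = 7 modulo 8. *)
have k1 : kappa R (4 * p) = 2 * (p %% 8 == 7).+1 %[mod 4].
  apply: (kappa_mod4 R hp p_odd (or_introl erefl) _ (is_genus_p hp4)) => //.
    by rewrite hp4.
  by move=> k c; apply: genus2_p.
have k2 : kappa R (8 * p) = 2 * (p %% 8 == 7).+1 %[mod 4].
  have p8 : 2 * p = 6 %[mod 8] by lia.
  have -> : 8 * p = 4 * (2 * p) by rewrite mulnA.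
  apply: (kappa_mod4 R hp p_odd (or_intror erefl) _ (is_genus_2p p8)) => //.
    by lia.
  by move=> k c; apply: genus2_2p.
by split=> p8; move: k1 k2; rewrite p8 /= => -> ->.
Qed.
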